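(* Let $D,M,K\ge1$ be integers, let $\boldsymbol\epsilon$ be a random vector in $\mathbb{R}^M$, and let $f:\mathbb{R}^D\times\mathbb{R}^M\to\mathbb{R}$ be such that the additivity of the median holds: $m_f(x,y)=m_f(x)-m_f(y)$ for all $x,y\in\mathbb{R}^D$. Let $\boldsymbol\epsilon_{i,k}$ ($i=1,2$; $k=1,\dots,K$) be i.i.d. copies of $\boldsymbol\epsilon$. Let $x_1,x_2\in\mathbb{R}^D$, let $\eta_{\mathrm{med}}(x_1,x_2)=\mathrm{sign}(m_f(x_1)-m_f(x_2))$, and let $$\widehat\eta^{\mathrm{SA}}_{\boldsymbol\epsilon}(x_1,x_2)=\mathrm{sign}\Big(\frac1K\sum_{k=1}^K\mathrm{sign}\big(f(x_1;\boldsymbol\epsilon_{1,k})-f(x_2;\boldsymbol\epsilon_{2,k})\big)\Big).$$ Let $\epsilon^f(x_1,x_2)=f(x_1;\boldsymbol\epsilon_1)-f(x_2;\boldsymbol\epsilon_2)$ with $\boldsymbol\epsilon_1,\boldsymbol\epsilon_2$ i.i.d. copies of $\boldsymbol\epsilon$. If $\eta_{\mathrm{med}}(x_1,x_2)\neq0$, then $$\Pr\big[\widehat\eta^{\mathrm{SA}}_{\boldsymbol\epsilon}(x_1,x_2)=\eta_{\mathrm{med}}(x_1,x_2)\big]\ \geq\ 1-\exp\Big(-\frac{K\cdot\big(\mathbb{E}[\mathrm{sign}(\epsilon^f(x_1,x_2))]\big)^2}{2}\Big).$$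
   Context: $\mathrm{sign}(\cdot)\in\{-1,0,1\}$ is the sign function. For each $x$, $f(x;\cdot)$ is measurable so that $f(x;\boldsymbol\epsilon)$ is a random variable. For a real random variable $X$ with cumulative distribution function $\phi(t)=\Pr[X\le t]$, the center of the median of $X$ is $\frac12\big(\inf\{t:\phi(t)>1/2\}+\sup\{t:\phi(t)<1/2\}\big)$. $m_f(x)$ denotes the center of the median of $f(x;\boldsymbol\epsilon)$, and $m_f(x,y)$ denotes the center of the median of $f(x;\boldsymbol\epsilon)-f(y;\boldsymbol\epsilon')$, where $\boldsymbol\epsilon'$ is an i.i.d. copy of $\boldsymbol\epsilon$. *)

(* Defs.v *)
From HB Require Import structures.
From mathcomp Require Import all_boot all_order all_algebra.
From mathcomp Require Import all_classical all_reals all_analysis.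
From mathcomp Require Import measurable_realfun.
Import Order.TTheory GRing.Theory Num.Theory.
Import numFieldNormedType.Exports.

Set Implicit Arguments.
Unset Strict Implicit.
Unset Printing Implicit Defensive.

Local Open Scope classical_set_scope.
Local Open Scope ring_scope.

Section defs.
Context {d : measure_display} {T : measurableType d} {R : realType}.
Variable P : probability T R.

Definition median_center (X : {RV P >-> R}) : R :=
  2^-1 * (inf [set t : R | ((2^-1)%:E < cdf X t)%E]
          + sup [set t : R | (cdf X t < (2^-1)%:E)%E]).

Section iid.
Context {d' : measure_display} {T' : measurableType d'}.

Definition mutually_independent (I : finType) (X : I -> {RV P >-> T'}) : Prop :=
  forall (J : {set I}) (A : I -> set T'), (forall i, measurable (A i)) ->
    P (\bigcap_(i in [set` J]) (X i @^-1` A i)) =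
    (\prod_(i in J) P (X i @^-1` A i))%E.

Definition same_law (X Y : {RV P >-> T'}) : Prop :=
  forall A : set T', measurable A -> distribution P X A = distribution P Y A.

Definition iid_copies (X : {RV P >-> T'}) (I : finType)
    (Y : I -> {RV P >-> T'}) : Prop :=
  mutually_independent Y /\ forall i, same_law (Y i) X.

(* [Y] is an i.i.d. copy of [X]: same law as [X] and independent of [X]. *)
Definition iid_copy (X Y : {RV P >-> T'}) : Prop :=
  iid_copies X (fun b : bool => if b then Y else X).
End iid.

(* R^n is represented by [n.-tuple R], whose sigma-algebra is the product of
   the Borel sigma-algebras; [f x] is measurable for each [x], and no
   measurability in [x] is imposed. *)
Section noisy_function.
Context {D M : nat}.
Variable f : D.-tuple R -> {mfun M.-tuple R >-> R}.
Implicit Types (x y : D.-tuple R) (u v : {RV P >-> M.-tuple R}).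

Definition noisy x u : {RV P >-> R} := f x \o u.

Definition noisy_diff x y u v : {RV P >-> R} :=
  (noisy x u : {mfun T >-> R}) - (noisy y v : {mfun T >-> R}).

Definition median1 u x : R := median_center (noisy x u).

Definition median2 u v x y : R := median_center (noisy_diff x y u v).

Definition eta_med u x1 x2 : R := Num.sg (median1 u x1 - median1 u x2).

(* The indices 1 and 2 are [ord0] and [ord_max] in ['I_2]. *)
Definition eta_SA (K : nat) (eps : 'I_2 * 'I_K -> {RV P >-> M.-tuple R})
    x1 x2 (w : T) : R :=
  Num.sg (K%:R^-1 * \sum_(k < K)
    Num.sg (f x1 (eps (ord0, k) w) - f x2 (eps (ord_max, k) w))).
End noisy_function.
End defs.

(* Main.v *)
(* Let Z = f(x1; eps) - f(x2; eps'). By additivity the sign sigma of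
   m_f(x1) - m_f(x2) is that of the median center of Z, and a positive
   (negative) median center forces Pr[Z <= 0] <= 1/2 (Pr[Z < 0] >= 1/2); either
   way sigma * E[sign Z] >= 0. The K signs X_k, multiplied by sigma, are i.i.d.
   with values in {-1,0,1} and mean mu = |E[sign Z]|, and the estimator errs
   exactly when their sum is <= 0. Enumerating the finitely many sign vectors,
   Pr[sum <= 0] <= (E[exp (- t X)])^K, and the best t gives
   sqrt (1 - mu^2)^K <= exp (- K mu^2 / 2). *)
Require Import Defs.
From HB Require Import structures.
From mathcomp Require Import all_boot all_order all_algebra.
From mathcomp Require Import all_classical all_reals all_analysis.
From mathcomp Require Import measurable_realfun.
Import Order.TTheory GRing.Theory Num.Theory.
Import numFieldNormedType.Exports.
Set Implicit Arguments.
Unset Strict Implicit.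
Unset Printing Implicit Defensive.
From mathcomp Require Import ring lra.
Local Open Scope classical_set_scope.
Local Open Scope ring_scope.

(** * The sign function and its three values *)

Section sign.
Context {R : realType}.

(** Reduces both the measurability and the expectation of a sign to those of two indicators. *)
Lemma sgr_indic (x : R) :
  Num.sg x = \1_`]0%R, +oo[ x - \1_`]-oo, 0%R[ x.
Proof.
have memE (i : interval R) : (x \in [set` i]) = (x \in i).
  by apply/idP/idP => [/set_mem//|]; exact: mem_set.
rewrite !indicE !memE !in_itv/= andbT; have [x0|x0|->] := ltgtP x 0.
- by rewrite ltr0_sg// sub0r.
- by rewrite gtr0_sg// subr0.
- by rewrite sgr0 subrr.
Qed.

Lemma measurable_sgr : measurable_fun setT (@Num.sg R).
Proof.
rewrite (_ : @Num.sg R = fun x => \1_`]0%R, +oo[ x - \1_`]-oo, 0%R[ x).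
  by apply: measurable_funB; exact: measurable_indic.
by apply/funext => x; exact: sgr_indic.
Qed.

Lemma sgr_eq1_set : [set x : R | Num.sg x = 1] = `]0%R, +oo[%classic.
Proof.
apply/seteqP; split=> x /=; rewrite in_itv/= andbT; last exact: gtr0_sg.
by rewrite -sgr_gt0 => ->.
Qed.

Lemma sgr_eqN1_set : [set x : R | Num.sg x = -1] = `]-oo, 0%R[%classic.
Proof.
apply/seteqP; split=> x /=; rewrite in_itv/=; last exact: ltr0_sg.
by rewrite -sgr_lt0 => ->; rewrite ltrN10.
Qed.

Lemma sgr_eq_sgr (x y : R) : x != 0 -> (Num.sg y = Num.sg x) <-> 0 < Num.sg x * y.
Proof.
have [x0|x0|->] := ltgtP x 0; last by [].
  rewrite (ltr0_sg x0) mulN1r oppr_gt0 => _.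
  by split=> [yN|/ltr0_sg//]; rewrite -sgr_lt0 yN ltrN10.
rewrite (gtr0_sg x0) mul1r => _.
by split=> [y1|/gtr0_sg//]; rewrite -sgr_gt0 y1.
Qed.

(** Signs are indexed by ['I_3] so that sign vectors form the finite type [{ffun 'I_K -> 'I_3}],
    over which a power of a sum can be expanded. *)
Definition sign_val (i : 'I_3) : R := i%:R - 1.

Lemma sign_val0 : sign_val ord0 = -1. Proof. by rewrite /sign_val sub0r. Qed.

Lemma sign_val_max : sign_val ord_max = 1.
Proof. by rewrite /sign_val/=; ring. Qed.

Lemma sign_val_inj : injective sign_val.
Proof.
by move=> i j /addIr/eqP; rewrite eqr_nat => /eqP ij; exact: val_inj.
Qed.

Lemma sgr_sign_val (x : R) : exists i, Num.sg x = sign_val i.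
Proof.
have [x0|x0|->] := ltgtP x 0.
- by exists ord0; rewrite sign_val0 ltr0_sg.
- by exists ord_max; rewrite sign_val_max gtr0_sg.
- by exists (lift ord0 ord0); rewrite sgr0 /sign_val/= subrr.
Qed.

End sign.

(** * Independence of a pair from an event: from rectangles to all measurable sets *)

Section pair_independence.
Context {d d' : measure_display} {T : measurableType d} {T' : measurableType d'}.
Context {R : realType} {P : probability T R}.

Lemma measurable_preimage_pair (U V : {mfun T >-> T'}) (C : set (T' * T')) :
  measurable C -> measurable [set w | C (U w, V w)].
Proof.
move=> mC; have mUV : measurable_fun setT (fun w => (U w, V w)).
  exact: measurable_fun_pair.
by rewrite -[X in measurable X]setTI; exact: mUV.
Qed.

(** When [P G] is positive, the law of [(U, V)] conditional on [G] agrees with the product law on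
    rectangles, so uniqueness of the product measure identifies the two. *)
Lemma pair_independent_of_event (X U V : {RV P >-> T'}) (G : set T) :
    measurable G ->
    (forall A B, measurable A -> measurable B ->
      P (G `&` (U @^-1` A `&` V @^-1` B)) =
      (P G * (distribution P X A * distribution P X B))%E) ->
  forall C, measurable C -> P (G `&` [set w | C (U w, V w)]) =
    (P G * (distribution P X \x distribution P X) C)%E.
Proof.
move=> mG rect C mC.
have fG : P G \is a fin_num by exact: fin_num_measure.
(* Conditioning on a null event is impossible, but then both sides vanish. *)
have [G0|G0] := eqVneq (P G) 0%E.
  rewrite G0 mul0e; apply/eqP; rewrite eq_le measure_ge0 andbT -G0.
  apply: le_measure; rewrite ?inE//.
  by apply: measurableI => //; exact: measurable_preimage_pair.
have mUV : measurable_fun setT (fun w => (U w, V w)).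
  exact: measurable_fun_pair.
have c0 : 0 <= (fine (P G))^-1 by rewrite invr_ge0 fine_ge0.
have fG0 : fine (P G) != 0 by rewrite fine_eq0.
(* The conditional law: [P] restricted to [G], pushed forward by [(U, V)], and scaled by the inverse
   of [P G]. *)
pose nu : {measure set (T' * T') -> \bar R} :=
  mscale (NngNum c0)
    (measure_function_pushforward__canonical__measure_function_Measure
      (mrestr P mG) mUV).
have nuE D : nu D = ((fine (P G))^-1%:E * P (G `&` [set w | D (U w, V w)]))%E.
  by rewrite /nu/= /mscale/= /pushforward /mrestr setIC.
have nurect A B : measurable A -> measurable B ->
    nu (A `*` B) = (distribution P X A * distribution P X B)%E.
  move=> mA mB; rewrite nuE rect// muleA -{2}(fineK fG) -EFinM mulVf//.
  by rewrite mul1e.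
rewrite (product_measure_unique nurect)// nuE muleA -{1}(fineK fG) -EFinM.
by rewrite mulfV// mul1e.
Qed.

End pair_independence.

(** * Independence of the K pairs of copies *)

Section pairs_of_copies.
Context {d d' : measure_display} {T : measurableType d} {T' : measurableType d'}.
Context {R : realType} {P : probability T R}.

(** On rectangles the event constrains each of the 2K copies separately, so mutual independence
    applies directly and the factors are regrouped by [k]. *)
Lemma pairs_of_copies_rectangles (K : nat) (X : {RV P >-> T'})
    (Y : 'I_2 * 'I_K -> {RV P >-> T'}) (A B : 'I_K -> set T') :
    iid_copies X Y -> (forall k, measurable (A k)) ->
    (forall k, measurable (B k)) ->
  P (\bigcap_(k in setT)
      [set w | (A k `*` B k) (Y (ord0, k) w, Y (ord_max, k) w)]) =
  (\prod_(k < K) (distribution P X \x distribution P X) (A k `*` B k))%E.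
Proof.
move=> [indY lawY] mA mB.
pose E (i : 'I_2 * 'I_K) := if i.1 == ord0 then A i.2 else B i.2.
have mE i : measurable (E i) by rewrite /E; case: ifP.
have -> : \bigcap_(k in setT)
    [set w | (A k `*` B k) (Y (ord0, k) w, Y (ord_max, k) w)] =
    \bigcap_(i in [set` [set: 'I_2 * 'I_K]%SET]) (Y i @^-1` E i).
  apply/seteqP; split=> w /= Hw.
    move=> [i k] _; rewrite /preimage /E/=; have [/= Ak Bk] := Hw k Logic.I.
    case: i => -[|[|//]] i2 /=.
      by rewrite (_ : Ordinal i2 = ord0)//; exact: val_inj.
    by rewrite (_ : Ordinal i2 = ord_max)//; exact: val_inj.
  by move=> k _; split; [have := Hw (ord0, k)|have := Hw (ord_max, k)];
    rewrite /= finset.in_setT; apply.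
rewrite indY//.
under eq_bigr => i _ do rewrite -[P _]/(distribution P (Y i) (E i)) lawY//.
rewrite (eq_bigl xpredT); last by move=> i; rewrite finset.in_setT.
rewrite -(pair_bigA _ (fun i k => distribution P X (E (i, k)))) exchange_big/=.
apply: eq_bigr => k _.
by rewrite product_measure1E// 2!big_ord_recl big_ord0 mule1.
Qed.

(** Mutual independence speaks of single copies only, while the sign of a difference is an event on
    a pair and not a rectangle. This lemma bridges the gap. *)
Lemma pairs_of_copies_independent (K : nat) (X : {RV P >-> T'})
    (Y : 'I_2 * 'I_K -> {RV P >-> T'}) (C : 'I_K -> set (T' * T')) :
    iid_copies X Y -> (forall k, measurable (C k)) ->
  P (\bigcap_(k in setT) [set w | C k (Y (ord0, k) w, Y (ord_max, k) w)]) =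
  (\prod_(k < K) (distribution P X \x distribution P X) (C k))%E.
Proof.
move=> iidY; set nu := (distribution P X \x distribution P X)%E.
pose ev k (D : set (T' * T')) := [set w | D (Y (ord0, k) w, Y (ord_max, k) w)].
(* The factors are freed from being rectangles one index at a time. *)
suff H n : forall C : 'I_K -> set (T' * T'), (forall k, measurable (C k)) ->
    (forall k : 'I_K, (n <= k)%N -> exists A B : set T',
      [/\ measurable A, measurable B & C k = A `*` B]) ->
    P (\bigcap_(k in setT) ev k (C k)) = (\prod_(k < K) nu (C k))%E.
  move=> mC; apply: (H K) => // k; by rewrite leqNgt ltn_ord.
elim: n => [|n IH] {}C mC rectC.
  have /choice[A /choice[B ABC]] k : exists A, exists B,
      [/\ measurable A, measurable B & C k = A `*` B] by exact: rectC.
  have -> : C = fun k => A k `*` B k by apply/funext => k; case: (ABC k).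
  apply: pairs_of_copies_rectangles => // k; by case: (ABC k).
have [Kn|nK] := leqP K n.
  by apply: IH => // k nk; have := ltn_ord k; rewrite ltnNge (leq_trans Kn).
(* [k0] is the index freed at this stage: [C' D] puts [D] there, and [G] below collects the
   conditions at the other indices. *)
pose k0 := Ordinal nK; pose C' D k := if k == k0 then D else C k.
pose G := \bigcap_(k in [set k | k != k0]) ev k (C k).
have capC' D : \bigcap_(k in setT) ev k (C' D k) = G `&` ev k0 D.
  apply/seteqP; split=> w /=.
    move=> Hw; split; last by have := Hw k0 Logic.I; rewrite /C' eqxx.
    by move=> k /= /negPf kk0; have := Hw k Logic.I; rewrite /C' kk0.
  move=> [Gw Dw] k _; rewrite /C'; case: eqVneq => [->//|kk0]; exact: Gw.
have prodC' D : (\prod_(k < K) nu (C' D k) =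
    \prod_(k < K | k != k0) nu (C k) * nu D)%E.
  rewrite (bigD1 k0)//= /C' eqxx muleC; congr (_ * _)%E.
  by apply: eq_bigr => k /negPf ->.
have mC' D : measurable D -> forall k, measurable (C' D k).
  by move=> mD k; rewrite /C'; case: ifP.
have capE A B : measurable A -> measurable B -> P (G `&` ev k0 (A `*` B)) =
    (\prod_(k < K | k != k0) nu (C k) * nu (A `*` B))%E.
  move=> mA mB; rewrite -capC' -prodC'; apply: IH.
    by apply: mC'; exact: measurableX.
  move=> k nk; rewrite /C'; case: eqVneq => [_|kk0]; first by exists A, B.
  apply: rectC; rewrite ltn_neqAle nk andbT; apply: contra kk0 => /eqP nk0.
  by apply/eqP/val_inj.
have mG : measurable G.
  apply: fin_bigcap_measurable => [|k _]; first exact: finite_finset.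
  exact: measurable_preimage_pair.
(* Taking the whole space for both sides of the rectangle in [capE] removes the condition at
   [k0]. *)
have PG : P G = (\prod_(k < K | k != k0) nu (C k))%E.
  have := capE _ _ measurableT measurableT.
  rewrite (_ : nu _ = 1%E); last first.
    rewrite /nu product_measure1E// -[RHS]mule1.
    by congr (_ * _)%E; exact: (probability_setT (distribution P X)).
  rewrite mule1.
  rewrite (_ : ev _ _ = setT) ?setIT//.
  by apply/seteqP; split.
have C'C : C' (C k0) = C.
  by apply/funext => k; rewrite /C'; case: eqVneq => // ->.
rewrite -{1}C'C capC' -{2}C'C prodC' -PG.
apply: pair_independent_of_event => // A B mA mB.
by rewrite PG -product_measure1E// -/nu -capE.
Qed.

End pairs_of_copies.

(** * Joint law of two distinct copies *)

Section copies.
Context {d d' : measure_display} {T : measurableType d} {T' : measurableType d'}.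
Context {R : realType} {P : probability T R}.

(** The case of [pair_independent_of_event] in which [G] is the sure event. It makes every pair of
    distinct copies interchangeable with any other. *)
Lemma iid_copies_pair_law (I : finType) (X : {RV P >-> T'})
    (Y : I -> {RV P >-> T'}) (i j : I) (C : set (T' * T')) :
    iid_copies X Y -> i != j -> measurable C ->
  P [set w | C (Y i w, Y j w)] = (distribution P X \x distribution P X)%E C.
Proof.
move=> [indY lawY] ij mC; rewrite -[X in P X]setTI.
rewrite (@pair_independent_of_event _ _ _ _ _ P X)//.
  by rewrite probability_setT mul1e.
move=> A B mA mB; rewrite probability_setT mul1e setTI.
pose E k := if k == i then A else B.
have mE k : measurable (E k) by rewrite /E; case: ifP.
have -> : Y i @^-1` A `&` Y j @^-1` B =
    \bigcap_(k in [set` [set i; j]%SET]) (Y k @^-1` E k).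
  apply/seteqP; split=> w /=.
    move=> [Aw Bw] k /=; rewrite !finset.inE /preimage /E => /orP[|] /eqP ->/=.
      by rewrite eqxx.
    by rewrite eq_sym (negPf ij).
  move=> Hw; split.
    by have := Hw i; rewrite /= !finset.inE eqxx /E /preimage/= eqxx; apply.
  have := Hw j; rewrite /= !finset.inE eqxx orbT /E /preimage/=.
  by rewrite eq_sym (negPf ij); apply.
rewrite indY//.
under eq_bigr => k _ do rewrite -[P _]/(distribution P (Y k) (E k)) lawY//.
rewrite finset.big_setU1 ?finset.inE//= finset.big_set1 /E eqxx.
by rewrite eq_sym (negPf ij).
Qed.

End copies.

(** * Chernoff bound for sums of i.i.d. signs *)

Section chernoff.
Context {R : realType}.

(* With a = (1 + mu)/2 and b = (1 - mu)/2, the optimal t is (ln a - ln b)/2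
   and the bound it gives is sqrt (1 - mu^2). *)
Lemma chernoff_three_point (pm p0 pp : R) :
    0 <= pm -> 0 <= p0 -> 0 <= pp -> pm + p0 + pp = 1 -> pm <= pp ->
  exists2 t, 0 <= t &
    pm * expR t + p0 + pp * expR (- t) <= expR (- ((pp - pm) ^+ 2 / 2)).
Proof.
move=> pm0 p00 pp0 sum1 pmpp; set mu := pp - pm.
have [mu1|mu1] := leP 1 mu.
  (* Here all the mass sits at 1, [b] below would vanish, and this [t] gives equality. *)
  exists (2^-1); first by rewrite invr_ge0.
  have -> : pm = 0 by rewrite /mu in mu1; lra.
  have -> : p0 = 0 by rewrite /mu in mu1; lra.
  have ppE : pp = 1 by rewrite /mu in mu1; lra.
  have -> : mu = 1 by rewrite /mu in mu1 *; lra.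
  by rewrite ppE mul0r !add0r mul1r expr1n mul1r.
pose a := (1 + mu) / 2; pose b := (1 - mu) / 2.
have a0 : 0 < a by rewrite /a /mu; lra.
have b0 : 0 < b by rewrite /b; lra.
(* [r] is the value of [expR (- t)] at the optimal [t]. *)
pose r := Num.sqrt (b / a).
have r0 : 0 < r by rewrite sqrtr_gt0 divr_gt0.
have r2 : r ^+ 2 = b / a by rewrite sqr_sqrtr// ltW// divr_gt0.
have r1 : r <= 1.
  rewrite -(@ler_pXn2r _ 2%N)// ?nnegrE ?(ltW r0)// r2 expr1n ler_pdivrMr//.
  by rewrite mul1r /a /b /mu; lra.
exists (- ln r); first by rewrite oppr_ge0 ln_le0.
rewrite opprK expRN lnK ?posrE//.
(* Both sides are the square root of [a * b]: the two exponential terms balance at the optimum. *)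
have br : b / r = a * r.
  apply: (mulIf (lt0r_neq0 r0)); rewrite -mulrA mulVf ?lt0r_neq0// mulr1.
  by rewrite -mulrA -expr2 r2 mulrC divfK// lt0r_neq0.
have rV : 2 <= r + r^-1.
  rewrite -subr_ge0 (_ : _ - 2 = (1 - r) ^+ 2 / r).
    by rewrite divr_ge0 ?sqr_ge0// ltW.
  by field; rewrite lt0r_neq0.
(* Moving half of the middle mass to each end turns [pm], [pp] into [b], [a], and can only increase
   the left side because [r + r^-1] is at least 2. *)
have le1 : pm * r^-1 + p0 + pp * r <= 2 * (a * r).
  rewrite mulr2n mulrDl mul1r -{1}br.
  have -> : pm = b - p0 / 2 by rewrite /b /mu; lra.
  have -> : pp = a - p0 / 2 by rewrite /a /mu; lra.
  have : p0 / 2 * 2 <= p0 / 2 * (r + r^-1) by rewrite ler_wpM2l// divr_ge0.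
  lra.
apply: (le_trans le1).
(* After squaring, the claim is [1 - mu ^+ 2 <= expR (- mu ^+ 2)]. *)
rewrite -(@ler_pXn2r _ 2%N)// ?nnegrE ?expR_ge0//; last first.
  by rewrite mulr_ge0// mulr_ge0 ?ltW.
have -> : (2 * (a * r)) ^+ 2 = 1 - mu ^+ 2.
  transitivity (2 ^+ 2 * a ^+ 2 * r ^+ 2); first by ring.
  rewrite r2 (_ : _ * (b / a) = 4 * (a * b)); first by rewrite /a /b; field.
  by field; rewrite lt0r_neq0.
rewrite -expRM_natl (_ : _ * - _ = - mu ^+ 2); last by field.
exact: expR_ge1Dx.
Qed.

Context {d : measure_display} {T : measurableType d} {P : probability T R}.

(** Independence enters as a product formula for the probability of each sign vector, so the
    exponential Markov inequality becomes a comparison of finite sums. *)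
Lemma sum_signs_gt0_probability (K : nat) (X : 'I_K -> T -> R) (p : 'I_3 -> R) :
    (forall k, measurable_fun setT (X k)) ->
    (forall k w, exists i, X k w = sign_val i) ->
    (forall i, 0 <= p i) -> \sum_i p i = 1 -> p ord0 <= p ord_max ->
    (forall s : {ffun 'I_K -> 'I_3},
      P (\bigcap_(k in setT) [set w | X k w = sign_val (s k)]) =
      (\prod_k p (s k))%:E) ->
  ((1 - expR (- (K%:R * (p ord_max - p ord0) ^+ 2 / 2)))%:E <=
    P [set w | (0 < \sum_k X k w)%R])%E.
Proof.
move=> mX Xval p0 p1 p02 PX.
have [t t0 tle] : exists2 t, 0 <= t &
    \sum_i p i * expR (- (t * sign_val i)) <=
    expR (- ((p ord_max - p ord0) ^+ 2 / 2)).
  pose i1 : 'I_3 := lift ord0 ord0.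
  have i2E : lift ord0 (lift ord0 ord0) = ord_max :> 'I_3 by exact: val_inj.
  have [//|//|//||//|t t0 tle] := @chernoff_three_point (p ord0) (p i1) (p ord_max).
    by rewrite -p1 !big_ord_recl big_ord0 addr0 i2E addrA.
  exists t => //; rewrite !big_ord_recl big_ord0 addr0 i2E addrA.
  rewrite /sign_val/= /bump/= addn0.
  by rewrite sub0r mulrN1 opprK subrr mulr0 oppr0 expR0 !mulr1 -addrA
    (_ : 2%:R - 1 = 1) ?mulr1 ?addrA//; lra.
pose D := [pred s : {ffun 'I_K -> 'I_3} | \sum_k sign_val (s k) <= 0 :> R].
pose ev (s : {ffun 'I_K -> 'I_3}) :=
  \bigcap_(k in setT) [set w | X k w = sign_val (s k)].
have mev s : measurable (ev s).
  apply: fin_bigcap_measurable => [|k _]; first exact: finite_finset.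
  rewrite -[X in measurable X]setTI.
  by apply: (mX k measurableT [set sign_val (s k)]); exact: measurable_set1.
have mS : measurable [set w | \sum_k X k w <= 0].
  rewrite -[X in measurable X]setTI.
  have mfS : measurable_fun setT (fun w => \sum_k X k w).
    exact: measurable_sum.
  rewrite (_ : [set w | _] = (fun w => \sum_k X k w) @^-1` `]-oo, 0]).
    exact: mfS.
  by apply/seteqP; split=> w /=; rewrite in_itv.
have -> : [set w | 0 < \sum_k X k w] = ~` [set w | \sum_k X k w <= 0].
  by apply/seteqP; split=> w /=; rewrite ltNge => /negP.
rewrite probability_setC// EFinB leeD2l// leeN2.
(* [D] holds the sign vectors with nonpositive sum; a union bound over them follows. *)
have cover : [set w | \sum_k X k w <= 0] `<=` \bigcup_(s in [set` D]) ev s.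
  move=> w /= Sw; have /choice[s sE] k := Xval k w.
  exists [ffun k => s k]; rewrite /= ?inE.
    by under eq_bigr => k _ do rewrite ffunE -sE.
  by move=> k _ /=; rewrite ffunE.
have fD : finite_set [set` D] by exact: finite_finset.
have /le_trans-> // := content_sub_fsum P
  fD (fun s _ => mev s) mS cover.
rewrite (_ : - (K%:R * _ ^+ 2 / 2) =
  K%:R * - ((p ord_max - p ord0) ^+ 2 / 2)); last by rewrite mulrN -mulrA.
rewrite expRM_natl.
apply: (@le_trans _ _ ((\sum_i p i * expR (- (t * sign_val i))) ^+ K)%:E).
  (* The power is expanded over all sign vectors; those outside [D] contribute nonnegative terms. *)
  rewrite -[K in X in (_ <= X)%E]card_ord -prodr_const bigA_distr_bigA/=.
  rewrite -sumEFin -(@bigfs _ _ _ _ (index_enum _)) ?index_enum_uniq//;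
    last by move=> s _; rewrite mem_index_enum.
  rewrite big_mkcond/=; apply: lee_sum => s _; case: ifPn => [sD|_]; last first.
    by rewrite lee_fin prodr_ge0// => k _; rewrite mulr_ge0 ?expR_ge0.
  (* On [D] the exponent is nonnegative, so the additional exponential factor is at least 1. *)
  rewrite PX lee_fin big_split/= ler_peMr ?prodr_ge0// -expR_sum.
  rewrite -[leLHS]expR0 ler_expR sumrN oppr_ge0 -mulr_sumr.
  by rewrite mulr_ge0_le0.
rewrite lee_fin; apply: lerXn2r; rewrite ?nnegrE ?expR_ge0//.
by apply: sumr_ge0 => i _; rewrite mulr_ge0 ?expR_ge0.
Qed.

End chernoff.

(** * The sign of the median center and the expected sign *)

Section median.
Context {d : measure_display} {T : measurableType d} {R : realType}.
Context {P : probability T R}.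

Lemma measurable_preimage (X : {RV P >-> R}) (A : set R) :
  measurable A -> measurable (X @^-1` A).
Proof. by move=> mA; rewrite -[X in measurable X]setTI; exact: measurable_funPT. Qed.

Lemma probability_gt_cdf (X : {RV P >-> R}) (t : R) :
  P (X @^-1` `]t, +oo[) = (1 - cdf X t)%E.
Proof.
rewrite -[cdf X t]/(P (X @^-1` `]-oo, t])) -probability_setC; last first.
  exact: measurable_preimage.
congr (P _); apply/seteqP; split=> w /=; rewrite !in_itv/= andbT ltNge.
  by move=> /negP.
by move=> /negP.
Qed.

(** With [cdf_lt_half] and monotonicity, this shows that the sets in [median_center] are nonempty
    and suitably bounded, so that [inf] and [sup] do not take default values. *)
Lemma cdf_gt_half (X : {RV P >-> R}) : exists t, ((2^-1)%:E < cdf X t)%E.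
Proof.
have h : ((2^-1)%:E < 1 :> \bar R)%E by rewrite lte_fin invf_lt1// ltr1n.
have [M [_ HM]] := cvg_cdfy1 X (open_ereal_gt' h).
by exists (M + 1); apply: HM; rewrite ltrDl.
Qed.

Lemma cdf_lt_half (X : {RV P >-> R}) : exists t, (cdf X t < (2^-1)%:E)%E.
Proof.
have h : (0 < (2^-1)%:E :> \bar R)%E by rewrite lte_fin invr_gt0.
have [M [_ HM]] := cvg_cdfNy0 X (open_ereal_lt' h).
by exists (M - 1); apply: HM; rewrite gtrDl oppr_lt0.
Qed.

(** By contraposition: if the cdf at 0 exceeds 1/2, then 0 lies in the first set and bounds the
    second from above, so neither [inf] nor [sup] is positive. *)
Lemma median_center_gt0 (X : {RV P >-> R}) :
  0 < median_center X -> (cdf X 0 <= (2^-1)%:E)%E.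
Proof.
move=> m0; rewrite leNgt; apply: contraTN m0 => h; rewrite -leNgt.
have cdf_half s t : (cdf X s < (2^-1)%:E)%E -> ((2^-1)%:E < cdf X t)%E -> s <= t.
  move=> s2 t2; rewrite leNgt; apply/negP => ts.
  have := cdf_nondecreasing X (ltW ts).
  by rewrite leNgt (lt_trans s2 t2).
have inf_le0 : inf [set t : R | ((2^-1)%:E < cdf X t)%E] <= 0.
  apply: ge_inf => //=; have [s s2] := cdf_lt_half X.
  by exists s => t /=; exact: cdf_half.
have sup_le0 : sup [set t : R | (cdf X t < (2^-1)%:E)%E] <= 0.
  by apply: ge_sup; [exact: cdf_lt_half|move=> s /= s2; exact: cdf_half].
by rewrite /median_center; lra.
Qed.

(** By contraposition: if negative values have probability below 1/2, so does the cdf at every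
    negative point, and neither [inf] nor [sup] is negative. *)
Lemma median_center_lt0 (X : {RV P >-> R}) :
  median_center X < 0 -> ((2^-1)%:E <= P (X @^-1` `]-oo, 0%R[))%E.
Proof.
move=> m0; rewrite leNgt; apply: contraTN m0 => h; rewrite -leNgt.
have cdf_neg t : t < 0 -> (cdf X t < (2^-1)%:E)%E.
  move=> t0; apply: le_lt_trans h; rewrite -[cdf X t]/(P (X @^-1` `]-oo, t])).
  apply: le_measure; rewrite ?inE.
  - exact: measurable_preimage.
  - exact: measurable_preimage.
  - by move=> w /=; rewrite !in_itv/= => /le_lt_trans; apply.
have [t0 ht0] := cdf_gt_half X.
rewrite /median_center mulr_ge0 ?invr_ge0// addr_ge0//.
  apply: lb_le_inf; first by exists t0.
  move=> t /= ht; rewrite leNgt; apply/negP => /cdf_neg.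
  by rewrite ltNge (ltW ht).
(* The cdf at 0 includes a possible atom there, so 0 may lie outside the set; the points [- e] lie
   in it. *)
apply/ler_addgt0Pl => e e0; rewrite -lerBlDl sub0r; apply: ub_le_sup; last first.
  by apply: cdf_neg; rewrite oppr_lt0.
exists t0 => s /= hs; rewrite leNgt; apply/negP => ts.
have := cdf_nondecreasing X (ltW ts).
by rewrite leNgt (lt_trans hs ht0).
Qed.

(** A positive center gives P(X > 0) >= 1/2 >= P(X < 0), a negative one the reverse; an atom at 0 is
    harmless since P(X < 0) is at most the cdf at 0. *)
Lemma median_center_sg_ge0 (X : {RV P >-> R}) :
  0 <= Num.sg (median_center X) *
    (fine (P (X @^-1` `]0%R, +oo[)) - fine (P (X @^-1` `]-oo, 0%R[))).
Proof.
have fpos : P (X @^-1` `]0%R, +oo[) \is a fin_num.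
  by apply: fin_num_measure; exact: measurable_preimage.
have fneg : P (X @^-1` `]-oo, 0%R[) \is a fin_num.
  by apply: fin_num_measure; exact: measurable_preimage.
have fcdf : cdf X 0 \is a fin_num.
  rewrite -[cdf X 0]/(P (X @^-1` `]-oo, 0%R])).
  by apply: fin_num_measure; exact: measurable_preimage.
have neg_le : (P (X @^-1` `]-oo, 0%R[) <= cdf X 0)%E.
  rewrite -[cdf X 0]/(P (X @^-1` `]-oo, 0%R])).
  apply: le_measure; rewrite ?inE; [exact: measurable_preimage..|].
  by move=> w /=; rewrite !in_itv/= => /ltW.
move: neg_le; rewrite probability_gt_cdf -(fineK fneg) -(fineK fcdf) -EFinB lee_fin/=.
move=> neg_le; have [m0|m0|m0] := ltgtP (median_center X) 0.
- have := median_center_lt0 m0; rewrite -(fineK fneg) lee_fin.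
  rewrite ltr0_sg// mulN1r; lra.
- have := median_center_gt0 m0; rewrite -(fineK fcdf) lee_fin.
  rewrite gtr0_sg// mul1r; lra.
- by rewrite m0 sgr0 mul0r.
Qed.

Lemma expectation_sg (X : {RV P >-> R}) :
  ('E_P[fun w => Num.sg (X w)] =
  P (X @^-1` `]0%R, +oo[) - P (X @^-1` `]-oo, 0%R[))%E.
Proof.
have mpos : measurable (X @^-1` `]0%R, +oo[) by exact: measurable_preimage.
have mneg : measurable (X @^-1` `]-oo, 0%R[) by exact: measurable_preimage.
rewrite -(expectation_indic P mpos) -(expectation_indic P mneg) -expectationB.
- by congr expectation; apply/funext => w; rewrite sgr_indic !indicE.
- by apply: (Lfun1_integrable _ _).2; exact: integrable_indic.
- by apply: (Lfun1_integrable _ _).2; exact: integrable_indic.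
Qed.

End median.

(** * Reduction of the estimator to a sum of i.i.d. signs *)

Theorem theorem9 (R : realType) (d : measure_display) (Omega : measurableType d)
    (P : probability Omega R) (D M K : nat)
    (hD : (1 <= D)%N) (hM : (1 <= M)%N) (hK : (1 <= K)%N)
    (eps eps' : {RV P >-> M.-tuple R})
    (heps' : iid_copy eps eps')
    (f : D.-tuple R -> {mfun M.-tuple R >-> R})
    (additivity : forall x y : D.-tuple R,
      median2 f eps eps' x y = median1 f eps x - median1 f eps y)
    (epsK : 'I_2 * 'I_K -> {RV P >-> M.-tuple R})
    (hepsK : iid_copies eps epsK)
    (eps12 : 'I_2 -> {RV P >-> M.-tuple R})
    (heps12 : iid_copies eps eps12)
    (x1 x2 : D.-tuple R)
    (hmed : eta_med f eps x1 x2 != 0) :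
  ((1 - expR (- (K%:R *
      (fine 'E_P[fun w => Num.sg
          (noisy_diff f x1 x2 (eps12 ord0) (eps12 ord_max) w)]) ^+ 2 / 2)))%:E
   <= P [set w | eta_SA f epsK x1 x2 w = eta_med f eps x1 x2])%E.
Proof.
set Z := noisy_diff f x1 x2 eps eps'.
set sigma := eta_med f eps x1 x2.
have sigmaE : sigma = Num.sg (median_center Z).
  by rewrite /sigma /eta_med -additivity.
have m0 : median_center Z != 0 by rewrite -sgr_eq0 -sigmaE.
have sigma2 : sigma = 1 \/ sigma = -1.
  rewrite sigmaE; have [n0|p0|z0] := ltgtP (median_center Z) 0.
  - by right; exact: ltr0_sg.
  - by left; exact: gtr0_sg.
  - by rewrite z0 eqxx in m0.
clearbody sigma.
pose delta (z : M.-tuple R * M.-tuple R) := f x1 z.1 - f x2 z.2.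
have mdelta : measurable_fun setT delta.
  by apply: measurable_funB; apply: measurableT_comp => //.
have lawZ (C : set (M.-tuple R * M.-tuple R)) : measurable C ->
    (distribution P eps \x distribution P eps)%E C =
    P [set w | C (eps w, eps' w)].
  move=> mC; rewrite -(@iid_copies_pair_law _ _ _ _ _ _ _ eps
    (fun b : bool => if b then eps' else eps) false true)//.
have mpre (A : set R) : measurable A -> measurable (delta @^-1` A).
  by move=> mA; rewrite -[X in measurable X]setTI; exact: mdelta.
(* The expected sign is stated with [eps12] and additivity with [eps], [eps']; both differences have
   the law of [delta] under the product law. *)
have law12 (A : set R) : measurable A ->
    P (noisy_diff f x1 x2 (eps12 ord0) (eps12 ord_max) @^-1` A) = P (Z @^-1` A).
  move=> mA; transitivity ((distribution P eps \x distribution P eps)%E (delta @^-1` A)).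
    rewrite -(@iid_copies_pair_law _ _ _ _ _ _ _ _ _ ord0 ord_max _ heps12)//.
    exact: mpre.
  by rewrite lawZ//; exact: mpre.
rewrite expectation_sg !law12//.
set a := P (Z @^-1` `]0%R, +oo[); set b := P (Z @^-1` `]-oo, 0%R[).
have fa : a \is a fin_num by apply: fin_num_measure; exact: measurable_preimage.
have fb : b \is a fin_num by apply: fin_num_measure; exact: measurable_preimage.
rewrite fineB//.
have := median_center_sg_ge0 Z; rewrite -sigmaE -/a -/b => sigmaab.
pose C (i : 'I_3) := delta @^-1` [set x | sigma * Num.sg x = sign_val i].
have msg (c : R) : measurable [set x : R | sigma * Num.sg x = c].
  rewrite -[X in measurable X]setTI.
  have msgr : measurable_fun setT (fun x : R => sigma * Num.sg x).
    by apply: measurable_funM => //; exact: measurable_sgr.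
  by apply: (msgr measurableT [set c]); exact: measurable_set1.
have mC i : measurable (C i) by apply: mpre; exact: msg.
pose p (i : 'I_3) := fine ((distribution P eps \x distribution P eps)%E (C i)).
pose ev i := Z @^-1` [set x | sigma * Num.sg x = sign_val i].
have pE i : p i = fine (P (ev i)) by rewrite /p lawZ.
(* For [sigma = -1] the two outer classes are exchanged, which flips the difference. *)
have p02 : p ord_max - p ord0 = sigma * (fine a - fine b).
  rewrite !pE /ev sign_val0 sign_val_max; case: sigma2 => ->.
    have mul1 c : [set x : R | 1 * Num.sg x = c] = [set x | Num.sg x = c].
      by apply/funext => x /=; rewrite mul1r.
    by rewrite !mul1 sgr_eq1_set sgr_eqN1_set mul1r.
  have mulN1 c : [set x : R | -1 * Num.sg x = c] = [set x | Num.sg x = - c].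
    by apply/seteqP; split=> x /=; rewrite mulN1r;
      [move=> <-|move=> ->]; rewrite opprK.
  by rewrite !mulN1 opprK sgr_eq1_set sgr_eqN1_set mulN1r opprB.
have p1 : \sum_i p i = 1.
  apply: EFin_inj; rewrite -sumEFin.
  have mev i : measurable (ev i) by apply: measurable_preimage; exact: msg.
  under eq_bigr => i _ do rewrite pE fineK ?fin_num_measure//.
  rewrite -measure_bigsetU_ord//; last first.
    by move=> i j _ _ [w []]; rewrite /ev/= => -> /sign_val_inj.
  rewrite -[RHS](probability_setT P); congr (P _); apply/seteqP; split=> // w _.
  (* As [sigma] is itself a sign, its product with the sign of [Z w] is the sign of a product, hence
     one of the three values. *)
  have [i iE] := sgr_sign_val (median_center Z * Z w).
  rewrite (bigD1 i)//=; left.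
  by rewrite /ev/= sigmaE -sgrM.
(* The positive factor 1/K leaves the sign unchanged, and a tie counts as an error because [sigma]
   is nonzero. *)
have -> : [set w | eta_SA f epsK x1 x2 w = sigma] = [set w | 0 < \sum_(k < K)
    sigma * Num.sg (delta (epsK (ord0, k) w, epsK (ord_max, k) w))].
  apply/funext => w /=; apply/propext.
  rewrite /eta_SA sgrM gtr0_sg ?invr_gt0 ?ltr0n// mul1r -mulr_sumr sigmaE.
  exact: sgr_eq_sgr.
have -> : (fine a - fine b) ^+ 2 = (p ord_max - p ord0) ^+ 2.
  by rewrite p02 exprMn; case: sigma2 => ->; rewrite ?sqrrN expr1n mul1r.
apply: sum_signs_gt0_probability => //.
- move=> k; apply: measurable_funM => //; apply: measurableT_comp.
    exact: measurable_sgr.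
  by apply: measurableT_comp => //; exact: measurable_fun_pair.
- by move=> k w; rewrite sigmaE -sgrM; exact: sgr_sign_val.
- by move=> i; rewrite pE fine_ge0.
- by rewrite -subr_ge0 p02.
- move=> s; have := pairs_of_copies_independent hepsK (fun k => mC (s k)).
  rewrite -prodEFin => ->; apply: eq_bigr => k _.
  rewrite /p fineK// lawZ//; apply: fin_num_measure.
  exact: (@measurable_preimage _ _ _ _ Z _ (msg _)).
Qed.
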